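(* For any homomorphism of commutative rings $\varphi:A\to B$ and any shape $\vec s=(n_1,\dots,n_k)$ (a tuple of $k\ge1$ positive integers), there is a canonical isomorphism of simplicial $B$-modules $$\theta_\bullet: X_\bullet(\vec s;A)\otimes_AB\ \xrightarrow{\ \cong\ }\ X_\bullet(\vec s;B).$$
   Context: Notation: $[p]=\{0,\dots,p\}$. For a shape $\vec s=(n_1,\dots,n_k)$ put $n=\min(n_1,\dots,n_k)-1$, $M_a(p)=n_a-1-n+p$ (so $M_a(p)\ge p$) and $I_p=\prod_{a=1}^k[M_a(p)]$ for $p\ge 0$. Let $\delta_i^q:[q-1]\to[q]$ be the increasing injection missing $i$ and $\sigma_i^q:[q+1]\to[q]$ the nondecreasing surjection taking the value $i$ twice. Define $\Delta_i^p=\prod_{a=1}^k\delta_i^{M_a(p)}:I_{p-1}\to I_p$ ($p\ge1$, $0\le i\le p$) and $\Sigma_i^p=\prod_{a=1}^k\sigma_i^{M_a(p)}:I_{p+1}\to I_p$ ($p\ge 0$, $0\le i\le p$). For a commutative ring $A$, the diagonal simplicial tensor module $X_\bullet(\vec s;A)$ is the simplicial $A$-module with $X_p=A^{I_p}$ (all functions $T:I_p\to A$), faces $d_i^p(T)=T\circ\Delta_i^p$ and degeneracies $s_i^p(T)=T\circ\Sigma_i^p$. The tensor product with $B$ is formed degreewise. The canonical map in degree $p$ sends $E_m\otimes b$ to $b\cdot E_m$, where $E_m$ is the indicator function of $m\in I_p$. *)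

(* Defs.v *)
From HB Require Import structures.
From mathcomp Require Import all_boot all_algebra.
From mathcomp Require Import zify.
From mathcomp Require Import boolp freeg.

Set Implicit Arguments.
Unset Strict Implicit.
Unset Printing Implicit Defensive.

Import GRing.Theory.
Local Open Scope ring_scope.
Local Open Scope quotient_scope.

Local Notation widS i := (widen_ord (leqnSn _) i).
Local Notation succ i := (fintype.lift ord0 i).

(* Tensor product of two modules over a commutative ring: the free abelian
   group on M * N modulo the subgroup generated by the bilinearity relations. *)
Section TensorProduct.
Variables (A : comPzRingType) (M N : lmodType A).

Inductive tensor_rel : {freeg (M * N)%type} -> Prop :=
| tensor_rel0 : tensor_rel 0
| tensor_relB x y : tensor_rel x -> tensor_rel y -> tensor_rel (x - y)
| tensor_relDl m m' n :
    tensor_rel (<< (m + m', n) >> - << (m, n) >> - << (m', n) >>)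
| tensor_relDr m n n' :
    tensor_rel (<< (m, n + n') >> - << (m, n) >> - << (m, n') >>)
| tensor_relZ a m n : tensor_rel (<< (a *: m, n) >> - << (m, a *: n) >>).

Definition tensor_relb : {pred {freeg (M * N)%type}} := fun x => `[< tensor_rel x >].

Lemma tensor_relb_closed : zmod_closed tensor_relb.
Proof.
split=> [|x y]; rewrite /in_mem /= /tensor_relb; first exact/asboolP/tensor_rel0.
by move=> /asboolP xP /asboolP yP; exact/asboolP/tensor_relB.
Qed.

HB.instance Definition _ :=
  GRing.isZmodClosed.Build {freeg (M * N)%type} tensor_relb tensor_relb_closed.

Definition tensor : Type := Quotient.quot tensor_relb.
HB.instance Definition _ := GRing.Zmodule.on tensor.

Definition tpi (x : {freeg (M * N)%type}) : tensor := \pi_(Quotient.quot tensor_relb) x.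

Fact tpi_is_zmod_morphism : zmod_morphism tpi.
Proof. by move=> x y; rewrite /tpi raddfB. Qed.
HB.instance Definition _ :=
  GRing.isZmodMorphism.Build {freeg (M * N)%type} tensor tpi tpi_is_zmod_morphism.

Definition pure_tensor (m : M) (n : N) : tensor := tpi << (m, n) >>.

Lemma tpi_rel x y : tensor_rel (x - y) -> tpi x = tpi y.
Proof.
move=> xyP; apply/eqP; rewrite /tpi -Quotient.idealrBE; exact/asboolP.
Qed.

Lemma pure_tensorDl m m' n :
  pure_tensor (m + m') n = pure_tensor m n + pure_tensor m' n.
Proof.
rewrite /pure_tensor -raddfD; apply: tpi_rel.
by rewrite opprD addrA; exact: tensor_relDl.
Qed.

Lemma pure_tensorDr m n n' :
  pure_tensor m (n + n') = pure_tensor m n + pure_tensor m n'.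
Proof.
rewrite /pure_tensor -raddfD; apply: tpi_rel.
by rewrite opprD addrA; exact: tensor_relDr.
Qed.

Lemma pure_tensorZ a m n : pure_tensor (a *: m) n = pure_tensor m (a *: n).
Proof. by apply: tpi_rel; exact: tensor_relZ. Qed.

Lemma tensor_ind (P : tensor -> Prop) :
    P 0 -> (forall x y, P x -> P y -> P (x - y)) ->
    (forall m n, P (pure_tensor m n)) ->
  forall x, P x.
Proof.
move=> P0 PB Pp.
have PN x : P x -> P (- x) by move=> Px; rewrite -sub0r; exact: PB.
have PD x y : P x -> P y -> P (x + y).
  by move=> Px Py; rewrite -[y]opprK; apply/PB/PN.
move=> x; rewrite -[x]reprK -/(tpi _); move: (repr x).
apply: freeg_ind_dom0 => [|c [m n] D _ _ PDD]; first by rewrite raddf0.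
rewrite raddfD; apply: (PD) => //.
have -> : << c *g (m, n) >> = << (m, n) >> *~ c :> {freeg (M * N)%type}.
  by rewrite freegU_mulz intz.
rewrite raddfMz -/(pure_tensor m n).
have PM k : P (pure_tensor m n *+ k).
  by elim: k => [|k IHk]; rewrite ?mulr0n // mulrS; apply: PD.
by case: c => k; [exact: PM | apply: PN; exact: PM].
Qed.

Section Lift.
Variables (V : zmodType) (f : M -> N -> V).

Definition balanced :=
  [/\ forall m m' n, f (m + m') n = f m n + f m' n,
      forall m n n', f m (n + n') = f m n + f m n' &
      forall a m n, f (a *: m) n = f m (a *: n)].

Let lift0 (x : {freeg (M * N)%type}) : V :=
  fglift (fun mn => f mn.1 mn.2 : zmodule V) x.

Let lift0B : {morph lift0 : x y / x - y}.
Proof. exact: (@lift_is_additive int _ (zmodule V)). Qed.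

Let lift0U m n : lift0 << (m, n) >> = f m n.
Proof. by rewrite /lift0 liftU /= scale1r. Qed.

Definition tensor_lift (x : tensor) : V := lift0 (repr (x : Quotient.quot tensor_relb)).

Hypothesis bal_f : balanced.

Let lift0_rel x : tensor_rel x -> lift0 x = 0.
Proof.
case: bal_f => fDl fDr fZ.
elim=> [|x' y _ x0 _ y0|m m' n|m n n'|a m n].
- by rewrite -[0 in LHS](subrr 0) lift0B subrr.
- by rewrite lift0B x0 y0 subrr.
- by rewrite !lift0B !lift0U fDl addrAC addrK subrr.
- by rewrite !lift0B !lift0U fDr addrAC addrK subrr.
- by rewrite lift0B !lift0U fZ subrr.
Qed.

Let lift0E x : tensor_lift (tpi x) = lift0 x.
Proof.
apply/eqP; rewrite /tensor_lift -subr_eq0 -lift0B; apply/eqP/lift0_rel/asboolP.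
rewrite -[`[< _ >]]/(_ \in tensor_relb).
have := Quotient.idealrBE tensor_relb
  (repr (tpi x : Quotient.quot tensor_relb)) x.
by rewrite reprK eqxx => ->.
Qed.

Lemma tensor_liftE m n : tensor_lift (pure_tensor m n) = f m n.
Proof. by rewrite lift0E lift0U. Qed.

Lemma tensor_liftB : zmod_morphism tensor_lift.
Proof.
move=> x y; rewrite -[x]reprK -[y]reprK -/(tpi _) -/(tpi (repr y)).
by rewrite -raddfB !lift0E lift0B.
Qed.

End Lift.
End TensorProduct.

Lemma tensor_ext (A : comPzRingType) (M N : lmodType A) (V : zmodType)
    (f g : tensor M N -> V) :
    zmod_morphism f -> zmod_morphism g ->
    (forall m n, f (pure_tensor m n) = g (pure_tensor m n)) ->
  f =1 g.
Proof.
move=> fB gB fg; apply: tensor_ind => // [|x y fgx fgy].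
  by rewrite -[0 in LHS](subrr 0) -[0 in RHS](subrr 0) fB gB !subrr.
by rewrite fB gB fgx fgy.
Qed.

Definition restr_scalars (A B : comPzRingType) (phi : {rmorphism A -> B}) : Type := B.

Section RestrScalars.
Variables (A B : comPzRingType) (phi : {rmorphism A -> B}).

HB.instance Definition _ := GRing.Zmodule.on (restr_scalars phi).

Let scale (a : A) (b : restr_scalars phi) : restr_scalars phi := phi a * (b : B).

Fact restr_scalarsA a b v : scale a (scale b v) = scale (a * b) v.
Proof. by rewrite /scale rmorphM mulrA. Qed.
Fact restr_scalars1 : left_id 1 scale.
Proof. by move=> v; rewrite /scale rmorph1 mul1r. Qed.
Fact restr_scalarsDr : right_distributive scale +%R.
Proof. by move=> a u v; exact: mulrDr. Qed.
Fact restr_scalarsDl v : {morph scale^~ v : a b / a + b}.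
Proof. by move=> a b; rewrite /scale rmorphD; exact: mulrDl. Qed.

HB.instance Definition _ := GRing.Zmodule_isLmodule.Build A (restr_scalars phi)
  restr_scalarsA restr_scalars1 restr_scalarsDr restr_scalarsDl.

Lemma restr_scalarsE (a : A) (b : restr_scalars phi) : a *: b = phi a * (b : B) :> B.
Proof. by []. Qed.

End RestrScalars.

Definition ext_scalars (A B : comPzRingType) (phi : {rmorphism A -> B})
  (M : lmodType A) : Type := tensor M (restr_scalars phi).

Section ExtScalars.
Variables (A B : comPzRingType) (phi : {rmorphism A -> B}).

Section Module.
Variable M : lmodType A.

HB.instance Definition _ := GRing.Zmodule.on (ext_scalars phi M).

Definition ext_pure (m : M) (b : B) : ext_scalars phi M :=
  pure_tensor m (b : restr_scalars phi).

Let scale_pure (b : B) (m : M) (b' : restr_scalars phi) : ext_scalars phi M :=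
  ext_pure m (b * (b' : B)).

Let scale (b : B) (x : ext_scalars phi M) : ext_scalars phi M :=
  tensor_lift (scale_pure b) x.

Let scale_pure_bal b : balanced (scale_pure b).
Proof.
split=> [m m' n|m n n'|a m n]; rewrite /scale_pure /ext_pure.
- exact: pure_tensorDl.
- by rewrite -pure_tensorDr; congr pure_tensor; exact: mulrDr.
- by rewrite pure_tensorZ; congr pure_tensor; rewrite !restr_scalarsE mulrCA.
Qed.

Let scaleE b m b' : scale b (ext_pure m b') = ext_pure m (b * b').
Proof. exact: tensor_liftE. Qed.

Let scaleB b : zmod_morphism (scale b).
Proof. exact: tensor_liftB. Qed.

Fact ext_scalarsA b c v : scale b (scale c v) = scale (b * c) v.
Proof.
apply: (tensor_ext (f := scale b \o scale c)) v => [x y||m n] /=.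
- by rewrite !scaleB.
- exact: scaleB.
- by rewrite !scaleE mulrA.
Qed.

Fact ext_scalars1 : left_id 1 scale.
Proof.
apply: (tensor_ext (g := id)) => [|x y //|m n]; first exact: scaleB.
by rewrite scaleE mul1r.
Qed.

Fact ext_scalarsDr : right_distributive scale +%R.
Proof.
move=> b x y; have s0 : scale b 0 = 0 by have := scaleB b 0 0; rewrite !subrr.
have sN z : scale b (- z) = - scale b z by rewrite -sub0r scaleB s0 sub0r.
by rewrite -[y in LHS]opprK scaleB sN opprK.
Qed.

Fact ext_scalarsDl v : {morph scale^~ v : b c / b + c}.
Proof.
move=> b c; apply: (tensor_ext (g := fun v => scale b v + scale c v)) v.
- exact: scaleB.
- by move=> x y; rewrite !scaleB opprD addrACA.
- by move=> m n; rewrite !scaleE mulrDl; exact: pure_tensorDr.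
Qed.

HB.instance Definition _ := GRing.Zmodule_isLmodule.Build B (ext_scalars phi M)
  ext_scalarsA ext_scalars1 ext_scalarsDr ext_scalarsDl.

Lemma ext_pureZ b m b' : b *: ext_pure m b' = ext_pure m (b * b').
Proof. exact: scaleE. Qed.

Lemma ext_scalars_ext (V : zmodType) (f g : ext_scalars phi M -> V) :
    zmod_morphism f -> zmod_morphism g ->
    (forall m b, f (ext_pure m b) = g (ext_pure m b)) ->
  f =1 g.
Proof. exact: tensor_ext. Qed.

End Module.

Section Map.
Variables (M M' : lmodType A) (f : {linear M -> M'}).

Definition ext_map : ext_scalars phi M -> ext_scalars phi M' :=
  tensor_lift (fun m (b : restr_scalars phi) => ext_pure (f m) b).

Let map_bal : balanced (fun m (b : restr_scalars phi) => ext_pure (f m) b).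
Proof.
split=> [m m' n|m n n'|a m n]; rewrite /ext_pure.
- by rewrite linearD; exact: pure_tensorDl.
- exact: pure_tensorDr.
- by rewrite linearZ; exact: pure_tensorZ.
Qed.

Lemma ext_mapE m b : ext_map (ext_pure m b) = ext_pure (f m) b.
Proof. exact: tensor_liftE. Qed.

Fact ext_map_is_zmod_morphism : zmod_morphism ext_map.
Proof. exact: tensor_liftB. Qed.

HB.instance Definition _ := GRing.isZmodMorphism.Build
  (ext_scalars phi M) (ext_scalars phi M') ext_map ext_map_is_zmod_morphism.

Fact ext_map_is_scalable : scalable ext_map.
Proof.
move=> b x; apply: (ext_scalars_ext (f := fun x => ext_map (b *: x))
  (g := fun x => b *: ext_map x)) x.
- by move=> x y /=; rewrite scalerBr raddfB.
- by move=> x y /=; rewrite raddfB scalerBr.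
- by move=> m n /=; rewrite ext_pureZ !ext_mapE ext_pureZ.
Qed.

HB.instance Definition _ := GRing.isScalable.Build
  B (ext_scalars phi M) (ext_scalars phi M') *:%R ext_map ext_map_is_scalable.

End Map.

Lemma ext_map_comp (M1 M2 M2' M3 : lmodType A) (f : {linear M2 -> M3})
    (g : {linear M1 -> M2}) (f' : {linear M2' -> M3}) (g' : {linear M1 -> M2'}) :
    (forall m, f (g m) = f' (g' m)) ->
  forall x, ext_map f (ext_map g x) = ext_map f' (ext_map g' x).
Proof.
move=> fg; apply: (ext_scalars_ext (f := ext_map f \o ext_map g)
  (g := ext_map f' \o ext_map g')) => [x y|x y|m n] /=.
- by rewrite !raddfB.
- by rewrite !raddfB.
- by rewrite !ext_mapE fg.
Qed.

Lemma ext_map_id (M1 M2 : lmodType A) (f : {linear M2 -> M1}) (g : {linear M1 -> M2}) :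
  (forall m, f (g m) = m) -> forall x, ext_map f (ext_map g x) = x.
Proof.
move=> fg; apply: (ext_scalars_ext (f := ext_map f \o ext_map g) (g := id)) => [x y|x y //|m n] /=.
- by rewrite !raddfB.
- by rewrite !ext_mapE fg.
Qed.

End ExtScalars.

Arguments ext_pure {A B} phi {M} m b.
Arguments ext_map {A B} phi {M M'} f x.

(* Each simplicial identity is reindexed so that both sides typecheck without
   casts: an index compared with a strictly larger one is written i <= j with
   the larger one replaced by succ j (value j.+1); widS i has value i. *)
Record simplicial_module (R : pzRingType) := SimplicialModule {
  smod_obj :> nat -> lmodType R;
  face : forall p, 'I_p.+2 -> {linear smod_obj p.+1 -> smod_obj p};
  degen : forall p, 'I_p.+1 -> {linear smod_obj p -> smod_obj p.+1};
  face_face : forall p (i j : 'I_p.+2) (x : smod_obj p.+2), (i <= j)%N ->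
    face i (face (succ j) x) = face j (face (widS i) x);
  degen_degen : forall p (i j : 'I_p.+1) (x : smod_obj p), (i <= j)%N ->
    degen (widS i) (degen j x) = degen (succ j) (degen i x);
  face_degen_lt : forall p (i : 'I_p.+2) (j : 'I_p.+1) (x : smod_obj p.+1),
    (i <= j)%N -> face (widS i) (degen (succ j) x) = degen j (face i x);
  face_degen_eq : forall p (j : 'I_p.+1) (x : smod_obj p),
    face (widS j) (degen j x) = x;
  face_degen_eqS : forall p (j : 'I_p.+1) (x : smod_obj p),
    face (succ j) (degen j x) = x;
  face_degen_gt : forall p (i : 'I_p.+2) (j : 'I_p.+1) (x : smod_obj p.+1),
    (j < i)%N -> face (succ i) (degen (widS j) x) = degen j (face i x)
}.

Arguments face {R} s {p} i.
Arguments degen {R} s {p} i.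

Record simplicial_hom (R : pzRingType) (X Y : simplicial_module R) := SimplicialHom {
  shom_fun :> forall p, {linear X p -> Y p};
  shom_face : forall p (i : 'I_p.+2) x, shom_fun p (face X i x) = face Y i (shom_fun p.+1 x);
  shom_degen : forall p (i : 'I_p.+1) x, shom_fun p.+1 (degen X i x) = degen Y i (shom_fun p x)
}.

Definition simplicial_iso (R : pzRingType) (X Y : simplicial_module R)
    (f : simplicial_hom X Y) : Prop :=
  exists g : simplicial_hom Y X, forall p, cancel (f p) (g p) /\ cancel (g p) (f p).

Section BaseChange.
Variables (A B : comPzRingType) (phi : {rmorphism A -> B}) (X : simplicial_module A).

Definition base_change : simplicial_module B :=
  @SimplicialModule B (fun p => ext_scalars phi (X p))
    (fun p i => ext_map phi (face X i)) (fun p i => ext_map phi (degen X i))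
    (fun p i j x ij => ext_map_comp (fun m => face_face m ij) x)
    (fun p i j x ij => ext_map_comp (fun m => degen_degen m ij) x)
    (fun p i j x ij => ext_map_comp (fun m => face_degen_lt m ij) x)
    (fun p j x => ext_map_id (face_degen_eq j) x)
    (fun p j x => ext_map_id (face_degen_eqS j) x)
    (fun p i j x ij => ext_map_comp (fun m => face_degen_gt m ij) x).

End BaseChange.

(* The coface 'I_q -> 'I_q.+1 missing i is [fintype.lift i]; this is the
   codegeneracy 'I_q.+2 -> 'I_q.+1 taking the value i twice (at i and at i.+1). *)
Definition codegen q (i : 'I_q.+1) (j : 'I_q.+2) : 'I_q.+1 := inord (unbump i j).

Lemma codegenE q (i : 'I_q.+1) (j : 'I_q.+2) : codegen i j = unbump i j :> nat.
Proof.
by rewrite inordK // /unbump; case: i j => [i ilt] [j jlt] /=; case: (ltnP i j); lia.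
Qed.

Section TensorModule.
Variables (k : nat) (s : k.-tuple nat).

(* The default [head 0 s] is the first entry of s, hence harmless in the minimum;
   the 0 is only reached for k = 0. *)
Definition shape_min : nat := \big[minn/head 0%N s]_(a < k) tnth s a.
Definition shape_deg : nat := shape_min.-1.

(* M_a(p) = n_a - 1 - n + p, where n_a - 1 - n >= 0 as soon as the n_a are
   positive; p comes first so that [index_max a p.+1] is convertible to
   [(index_max a p).+1]. *)
Definition index_max (a : 'I_k) (p : nat) : nat := (p + ((tnth s a).-1 - shape_deg))%N.

Definition index_set (p : nat) : finType := {dffun forall a : 'I_k, 'I_(index_max a p).+1}.

Definition index_emb (a : 'I_k) p (i : 'I_p.+1) : 'I_(index_max a p).+1 :=
  widen_ord (leq_addr _ p.+1) i.

Definition index_coface p (i : 'I_p.+2) (m : index_set p) : index_set p.+1 :=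
  finfun (fun a => fintype.lift (index_emb a i) (m a)).

Definition index_codegen p (i : 'I_p.+1) (m : index_set p.+1) : index_set p :=
  finfun (fun a => codegen (index_emb a i) (m a)).

Let index_ext p (m m' : index_set p) : (forall a, m a = m' a :> nat) -> m = m'.
Proof. by move=> mm'; apply/ffunP => a; exact: val_inj (mm' a). Qed.

Fact index_coface_coface p (i j : 'I_p.+2) m : (i <= j)%N ->
  index_coface (succ j) (index_coface i m) = index_coface (widS i) (index_coface j m).
Proof.
move=> ij; apply: index_ext => a; rewrite !ffunE /= /bump /=.
by move: (nat_of_ord (m a)) => n; lia.
Qed.

Fact index_codegen_codegen p (i j : 'I_p.+1) m : (i <= j)%N ->
  index_codegen j (index_codegen (widS i) m) = index_codegen i (index_codegen (succ j) m).
Proof.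
move=> ij; apply: index_ext => a; rewrite !(ffunE, codegenE) /= /bump /unbump /=.
by move: (nat_of_ord (m a)) => n; lia.
Qed.

Fact index_codegen_coface_lt p (i : 'I_p.+2) (j : 'I_p.+1) m : (i <= j)%N ->
  index_codegen (succ j) (index_coface (widS i) m) = index_coface i (index_codegen j m).
Proof.
move=> ij; apply: index_ext => a; rewrite !(ffunE, codegenE) /= /bump /unbump /=.
by rewrite codegenE /unbump; move: (nat_of_ord (m a)) => n /=; lia.
Qed.

Fact index_codegen_coface_eq p (j : 'I_p.+1) m :
  index_codegen j (index_coface (widS j) m) = m.
Proof.
apply: index_ext => a; rewrite !(ffunE, codegenE) /= /bump /unbump /=.
by move: (nat_of_ord (m a)) => n; lia.
Qed.

Fact index_codegen_coface_eqS p (j : 'I_p.+1) m :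
  index_codegen j (index_coface (succ j) m) = m.
Proof.
apply: index_ext => a; rewrite !(ffunE, codegenE) /= /bump /unbump /=.
by move: (nat_of_ord (m a)) => n; lia.
Qed.

Fact index_codegen_coface_gt p (i : 'I_p.+2) (j : 'I_p.+1) m : (j < i)%N ->
  index_codegen (widS j) (index_coface (succ i) m) = index_coface i (index_codegen j m).
Proof.
move=> ij; apply: index_ext => a; rewrite !(ffunE, codegenE) /= /bump /unbump /=.
by rewrite codegenE /unbump; move: (nat_of_ord (m a)) => n /=; lia.
Qed.

End TensorModule.

Section Pullback.
Variables (A : pzRingType) (I J : finType) (h : I -> J).

Definition pullback (T : {ffun J -> A^o}) : {ffun I -> A^o} := [ffun x => T (h x)].

Fact pullback_is_linear : linear pullback.
Proof. by move=> a T U; apply/ffunP => x; rewrite !ffunE. Qed.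

HB.instance Definition _ := GRing.isLinear.Build
  A {ffun J -> A^o} {ffun I -> A^o} *:%R pullback pullback_is_linear.

End Pullback.

Lemma pullback_comp (A : pzRingType) (I J J' K : finType) (f : I -> J) (g : J -> K)
    (f' : I -> J') (g' : J' -> K) :
    (forall x, g (f x) = g' (f' x)) ->
  forall T : {ffun K -> A^o}, pullback f (pullback g T) = pullback f' (pullback g' T).
Proof. by move=> fg T; apply/ffunP => x; rewrite !ffunE fg. Qed.

Lemma pullback_id (A : pzRingType) (I J : finType) (f : I -> J) (g : J -> I) :
    (forall x, g (f x) = x) ->
  forall T : {ffun I -> A^o}, pullback f (pullback g T) = T.
Proof. by move=> fg T; apply/ffunP => x; rewrite !ffunE fg. Qed.

Arguments pullback A {I J} h T.

Definition tensor_module (A : comPzRingType) (k : nat) (s : k.-tuple nat) :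
    simplicial_module A :=
  @SimplicialModule A (fun p => {ffun index_set s p -> A^o})
    (fun p i => pullback A (index_coface i)) (fun p i => pullback A (index_codegen i))
    (fun p i j T ij => pullback_comp (fun m => index_coface_coface m ij) T)
    (fun p i j T ij => pullback_comp (fun m => index_codegen_codegen m ij) T)
    (fun p i j T ij => pullback_comp (fun m => index_codegen_coface_lt m ij) T)
    (fun p j T => pullback_id (index_codegen_coface_eq j) T)
    (fun p j T => pullback_id (index_codegen_coface_eqS j) T)
    (fun p i j T ij => pullback_comp (fun m => index_codegen_coface_gt m ij) T).

Definition indicator (A : comPzRingType) (k : nat) (s : k.-tuple nat) (p : nat)
    (m : index_set s p) : tensor_module A s p :=
  [ffun x : index_set s p => (x == m)%:R : A^o].

(* Main.v *)
(** Base change along [phi] commutes with the free module functor [A^I] for finite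
    [I]: [T (x) b |-> (m |-> phi (T m) * b)] is an isomorphism onto [B^I], with inverse
    [U |-> \sum_m E_m (x) U m]. Since faces and degeneracies are precompositions with
    maps of index sets, and the isomorphism is defined pointwise, it commutes with them. *)

Require Import Defs.
From HB Require Import structures.
From mathcomp Require Import all_boot all_algebra.

Import GRing.Theory.
Local Open Scope ring_scope.

(** A degreewise inverse of a simplicial map is automatically simplicial: after applying the
    injective map [f p], compatibility of [g] with faces and degeneracies reduces to that of [f]. *)
Lemma simplicial_iso_can (R : pzRingType) (X Y : simplicial_module R)
    (f : simplicial_hom X Y) (g : forall p, {linear Y p -> X p}) :
    (forall p, cancel (f p) (g p)) -> (forall p, cancel (g p) (f p)) ->
  simplicial_iso f.
Proof.
move=> fK gK.
have g_face p (i : 'I_p.+2) y : g p (face Y i y) = face X i (g p.+1 y).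
  by apply: (can_inj (fK p)); rewrite shom_face !gK.
have g_degen p (i : 'I_p.+1) y : g p.+1 (degen Y i y) = degen X i (g p y).
  by apply: (can_inj (fK p.+1)); rewrite shom_degen !gK.
by exists (@SimplicialHom R Y X g g_face g_degen) => p; split; [exact: fK | exact: gK].
Qed.

Lemma ext_pure_suml (A B : comPzRingType) (phi : {rmorphism A -> B}) (M : lmodType A)
    (J : finType) (F : J -> M) (b : B) :
  ext_pure phi (\sum_j F j) b = \sum_j ext_pure phi (F j) b.
Proof.
apply: (big_morph (ext_pure phi ^~ b)) => [x y|]; first exact: pure_tensorDl.
(* A pure tensor with left factor 0 equals its own double, so it vanishes by cancellation. *)
apply: (addIr (ext_pure phi 0 b)); rewrite add0r -[in RHS](addr0 0).
exact/esym/pure_tensorDl.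
Qed.

Section FreeBaseChange.
Variables (A B : comPzRingType) (phi : {rmorphism A -> B}) (I : finType).

Let ext_ffun_fun (T : {ffun I -> A^o}) (b : restr_scalars phi) : {ffun I -> B^o} :=
  [ffun m => phi (T m) * (b : B)].

Definition ext_ffun : ext_scalars phi {ffun I -> A^o} -> {ffun I -> B^o} :=
  tensor_lift ext_ffun_fun.

Let ext_ffun_balanced : balanced ext_ffun_fun.
Proof.
split=> [T T' b|T b b'|a T b]; apply/ffunP => m; rewrite !ffunE.
- by rewrite rmorphD mulrDl.
- exact: mulrDr.
(* [A] acts on [B] through [phi], so both sides are the product of [phi a], [phi (T m)] and [b]. *)
- by rewrite restr_scalarsE rmorphM mulrCA mulrA.
Qed.

Lemma ext_ffunE T b m : ext_ffun (ext_pure phi T b) m = phi (T m) * b.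
Proof. by rewrite /ext_ffun tensor_liftE // ffunE. Qed.

Fact ext_ffun_is_zmod_morphism : zmod_morphism ext_ffun.
Proof. exact: tensor_liftB. Qed.

HB.instance Definition _ := GRing.isZmodMorphism.Build
  (ext_scalars phi {ffun I -> A^o}) {ffun I -> B^o} ext_ffun ext_ffun_is_zmod_morphism.

Fact ext_ffun_is_scalable : scalable ext_ffun.
Proof.
move=> b x; apply: (@ext_scalars_ext _ _ _ _ _ (fun x => ext_ffun (b *: x))
  (fun x => b *: ext_ffun x) _ _ _ x) => [{}x y|{}x y|T b'] /=.
- by rewrite scalerBr raddfB.
- by rewrite raddfB scalerBr.
- by apply/ffunP => m; rewrite ext_pureZ !ffunE !ext_ffunE mulrCA.
Qed.

HB.instance Definition _ := GRing.isScalable.Build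
  B (ext_scalars phi {ffun I -> A^o}) {ffun I -> B^o} *:%R ext_ffun ext_ffun_is_scalable.

(** The standard basis of [A^I]; [indicator] is the case [I = index_set s p]. *)
Definition ffun_delta (m : I) : {ffun I -> A^o} := [ffun x => (x == m)%:R : A^o].

Definition ffun_ext (U : {ffun I -> B^o}) : ext_scalars phi {ffun I -> A^o} :=
  \sum_m ext_pure phi (ffun_delta m) (U m).

Fact ffun_ext_is_linear : linear ffun_ext.
Proof.
move=> b U V; rewrite /ffun_ext scaler_sumr -big_split /=.
apply: eq_bigr => m _; rewrite ext_pureZ !ffunE; exact: pure_tensorDr.
Qed.

HB.instance Definition _ := GRing.isLinear.Build
  B {ffun I -> B^o} (ext_scalars phi {ffun I -> A^o}) *:%R ffun_ext ffun_ext_is_linear.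

Lemma ffun_extK : cancel ffun_ext ext_ffun.
Proof.
move=> U; apply/ffunP => m; rewrite raddf_sum sum_ffunE (bigD1 m) //= big1 => [|m' m'm].
  by rewrite ext_ffunE ffunE eqxx rmorph1 mul1r addr0.
by rewrite ext_ffunE ffunE eq_sym (negPf m'm) rmorph0 mul0r.
Qed.

Lemma ffun_sum_delta (T : {ffun I -> A^o}) : T = \sum_m (T m : A) *: ffun_delta m.
Proof.
apply/ffunP => m; rewrite sum_ffunE (bigD1 m) //= big1 => [|m' m'm].
  (* The scalar action on [A^o] is multiplication in [A], hence [mulr1] and [mulr0]. *)
  by rewrite !ffunE eqxx addr0; exact/esym/mulr1.
by rewrite !ffunE eq_sym (negPf m'm); exact: mulr0.
Qed.

(** By additivity pure tensors suffice. Expanding [T] in the standard basis, each coefficient [T m]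
    crosses the tensor sign and becomes multiplication by [phi (T m)] on [b]. *)
Lemma ext_ffunK : cancel ext_ffun ffun_ext.
Proof.
apply: (@ext_scalars_ext _ _ _ _ _ (ffun_ext \o ext_ffun) id) => [x y|x y //|T b] /=.
  by rewrite !raddfB.
rewrite [in RHS](ffun_sum_delta T) ext_pure_suml; apply: eq_bigr => m _.
by rewrite ext_ffunE; exact/esym/pure_tensorZ.
Qed.

End FreeBaseChange.

Arguments ext_ffun {A B} phi I x.
Arguments ffun_ext {A B} phi I U.

(** Naturality in the index set: both composites send [T (x) b] to the function
    [m |-> phi (T (h m)) * b]. *)
Lemma ext_ffun_pullback (A B : comPzRingType) (phi : {rmorphism A -> B})
    (I J : finType) (h : I -> J) (x : ext_scalars phi {ffun J -> A^o}) :
  ext_ffun phi I (ext_map phi (pullback A h) x) = pullback B h (ext_ffun phi J x).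
Proof.
apply: (@ext_scalars_ext _ _ _ _ _ (ext_ffun phi I \o ext_map phi (pullback A h))
  (pullback B h \o ext_ffun phi J) _ _ _ x) => [{}x y|{}x y|T b] /=.
- by rewrite !raddfB.
- by rewrite !raddfB.
- by apply/ffunP => m; rewrite ext_mapE ffunE !ext_ffunE ffunE.
Qed.

Theorem proposition2p8 (A B : comPzRingType) (phi : {rmorphism A -> B})
    (k : nat) (s : k.-tuple nat) (k_gt0 : (0 < k)%N)
    (s_gt0 : forall a : 'I_k, (0 < tnth s a)%N) :
  exists theta : simplicial_hom (base_change phi (tensor_module A s)) (tensor_module B s),
    simplicial_iso theta /\
    forall (p : nat) (m : index_set s p) (b : B),
      theta p (ext_pure phi (indicator A m) b) = b *: indicator B m.
Proof.
pose theta := @SimplicialHom B (base_change phi (tensor_module A s)) (tensor_module B s)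
  (fun p => ext_ffun phi (index_set s p))
  (fun p i x => @ext_ffun_pullback _ _ phi _ _ (index_coface i) x)
  (fun p i x => @ext_ffun_pullback _ _ phi _ _ (index_codegen i) x).
exists theta; split.
  apply: (@simplicial_iso_can _ _ _ theta (fun p => ffun_ext phi (index_set s p))) => p.
  - exact: ext_ffunK.
  - exact: ffun_extK.
(* The values of an indicator are 0 and 1, which [phi] preserves; only the order of the two factors
   remains to be exchanged. *)
move=> p m b; apply/ffunP => x; rewrite /= ext_ffunE !ffunE rmorph_nat.
exact: mulrC.
Qed.
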